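(* If $(u_n)_{n\ge 1}$ is a computable sequence of real numbers such that $\sum_{n=1}^{\infty} u_n^2=\infty$, then $\sum_{n=1}^{\infty} \varepsilon_n u_n$ diverges for each algorithmically random Rademacher sequence $(\varepsilon_n)$.
   Context: Write $\mathcal{N}=\{-1,1\}^{\omega}$ for the space of infinite sequences of $\pm1$. For $\alpha\in\mathcal{N}$ let $\overline{\alpha}(n)$ be its initial segment of length $n$. $K$ denotes (prefix-free, i.e. self-delimiting) Kolmogorov complexity of finite strings. A sequence $\alpha\in\mathcal{N}$ is Kolmogorov-Chaitin complex if there is $k$ such that $K(\overline{\alpha}(n))\ge n-k$ for all $n$; the set of such $\alpha$ is denoted $KC$. A sequence $(\varepsilon_n)$ is an algorithmically random Rademacher sequence if there is some $\alpha\in KC$ such that $\varepsilon_n\in\{-1,1\}$ is the $n$th bit of $\alpha$ for every $n$. A sequence $(x_n)$ of real numbers is a computable sequence if there is an effective way of approximating $x_n$ arbitrarily closely, given $n$. *)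

(* Defs.v *)
From HB Require Import structures.
From mathcomp Require Import all_boot all_order all_algebra.
From mathcomp Require Import all_classical all_reals all_analysis.

Set Implicit Arguments.
Unset Strict Implicit.
Unset Printing Implicit Defensive.

Import Order.TTheory GRing.Theory Num.Theory.
Import numFieldNormedType.Exports.

Local Open Scope classical_set_scope.
Local Open Scope ring_scope.

Inductive recfun : nat -> Type :=
| rf_zero k : recfun k
| rf_succ : recfun 1
| rf_proj k (i : 'I_k) : recfun k
| rf_comp k m (f : recfun m) (g : 'I_m -> recfun k) : recfun k
| rf_prec k (f : recfun k) (g : recfun k.+2) : recfun k.+1
| rf_mu k (f : recfun k.+1) : recfun k.

(* [rf_eval f v y]: f is defined at v, with value y.  Primitive recursion and
   minimization both act on the first argument:
     prec f g (0, v) = f v,   prec f g (n+1, v) = g (n, prec f g (n, v), v),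
     mu f v = the least y such that f (y, v) = 0, provided that f (i, v) is
              defined for every i < y. *)
Fixpoint rf_eval k (f : recfun k) : k.-tuple nat -> nat -> Prop :=
  match f in recfun k return k.-tuple nat -> nat -> Prop with
  | rf_zero _ => fun _ y => y = 0%N
  | rf_succ => fun v y => y = (thead v).+1
  | rf_proj _ i => fun v y => y = tnth v i
  | rf_comp _ m f g => fun v y =>
      exists2 w : m.-tuple nat,
        (forall i, rf_eval (g i) v (tnth w i)) & rf_eval f w y
  | rf_prec _ f g => fun v =>
      (fix prec (n : nat) (y : nat) {struct n} : Prop :=
         match n with
         | 0%N => rf_eval f (behead_tuple v) y
         | m.+1 => exists2 z : nat,
             prec m z & rf_eval g (cons_tuple m (cons_tuple z (behead_tuple v))) y
         end) (thead v)
  | rf_mu _ f => fun v y =>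
      rf_eval f (cons_tuple y v) 0%N /\
      forall i, (i < y)%N -> exists z, rf_eval f (cons_tuple i v) z.+1
  end.

Definition computable2 (f : nat -> nat -> nat) : Prop :=
  exists c : recfun 2, forall n k, rf_eval c [tuple n; k] (f n k).

(* Bijective base-2 numeration, a bijection between finite strings and nat. *)
Fixpoint str_code (s : bitseq) : nat :=
  if s is b :: s' then ((str_code s').*2 + b).+1 else 0%N.

(* A machine is a partial function on strings; [None] means divergence. *)
Definition machine := bitseq -> option bitseq.

Definition computable_machine (M : machine) : Prop :=
  exists c : recfun 1, forall (p : bitseq) (y : nat),
    rf_eval c [tuple str_code p] y <->
    exists2 x, M p = Some x & y = str_code x.

Definition prefix_free (M : machine) : Prop :=
  forall p q, M p != None -> M q != None -> prefix p q -> p = q.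

Definition prefix_machine (M : machine) : Prop :=
  computable_machine M /\ prefix_free M.

Definition universal_prefix_machine (U : machine) : Prop :=
  prefix_machine U /\
  forall M, prefix_machine M ->
    exists c : nat, forall p x, M p = Some x ->
      exists2 q, U q = Some x & (size q <= size p + c)%N.

Definition program_lengths (M : machine) (x : bitseq) : set nat :=
  [set size p | p in [set p | M p = Some x]].

(* The length of a shortest program for x.  The default value 0 is never taken
   when M is universal, since then every x has a program. *)
Definition K (M : machine) (x : bitseq) : nat :=
  xget 0%N [set n | program_lengths M x n /\
                    forall m, program_lengths M x m -> (n <= m)%N].

(* A point of {-1,1}^omega is given by its bits, true for 1 and false for -1;
   sequences are indexed from 0, so that [alpha n] is the (n+1)st bit. *)
Definition sgn_bit (R : realType) (b : bool) : R := if b then 1 else -1.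

Definition KC (U : machine) : set (nat -> bool) :=
  [set alpha | exists k : nat, forall n, (n - k <= K U (mkseq alpha n))%N].

Definition random_rademacher (R : realType) (U : machine) (eps : R^nat) : Prop :=
  exists2 alpha, KC U alpha & forall n, eps n = sgn_bit R (alpha n).

(* The rationals approximating u are (-1)^s a / b with s, a, b recursive. *)
Definition computable_real_seq (R : realType) (u : R^nat) : Prop :=
  exists s a b : nat -> nat -> nat,
    [/\ computable2 s, computable2 a, computable2 b,
        forall n k, b n k != 0%N &
        forall n k,
          `| u n - (-1) ^+ s n k * (a n k)%:R / (b n k)%:R | <= 2 ^- k].

(* Main.v *)
Require Import Defs.
From mathcomp Require Import all_boot all_order all_algebra.
From mathcomp Require Import all_classical all_reals all_analysis.
From mathcomp Require Import zify ring lra.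
Import Order.TTheory GRing.Theory Num.Theory.
Import numFieldNormedType.Exports.
Local Open Scope classical_set_scope.
Local Open Scope ring_scope.

(** If the series converged, its partial sums would be bounded, and so would
    be those of the signed series of the rationals [v j] approximating [u j]
    within [2 ^- j]: their absolute values stay below some natural number [c],
    hence [`|v j| <= 2 * c], while [\sum_j v j ^+ 2] still diverges.  So every
    initial segment of the random sequence is the sign pattern of a walk that
    has never left the interval [[-c, c]].  Such patterns are both rare and
    recognizable by an algorithm, which contradicts randomness.

    Rare ([confined_energy], [confined_thin]): the expected square of the walk
    stopped at its exit from the interval is bounded, because a step overshoots
    by at most [2 * c].  It is also at least the probability of having stayed
    up to time [n] times [\sum_(j < n) v j ^+ 2], because each step of a walk
    still running adds [v j ^+ 2] to the expected square.  The probability of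
    staying therefore tends to [0].

    Recognizable ([confined_decidable]): with a common denominator, the
    confinement of a rational walk is an inequality between natural numbers
    computed by recursion from the code of the string.

    Compression ([thin_not_KC]): let [P] be a decidable set of strings such
    that for each [m], at some length, [P] contains a proportion at most
    [4 ^- m] of all strings.  For the least such length [n], a member [x] of
    length [n] is determined by [m] and by its rank among the members of length
    [n], a number of [n - 2 * m] bits.  The program [0^m 1 w], with [w] the
    rank, has length [n - m + 1], and these programs form a prefix-free set
    since [m] determines [n].  If [P] contains all initial segments of [alpha],
    their complexities are thus not bounded below by [n - k] for any [k].

    The machine reading these programs must be given by a term of [recfun].
    Its graph is decidable, so the machine is a single minimization
    ([computable_machine_graph]), and only total functions built from bounded
    sums, products and quantifiers have to be represented. *)

Local Open Scope nat_scope.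

(** * Total recursive functions *)

Lemma rf_eval_inj k (f : recfun k) v y z :
  rf_eval f v y -> rf_eval f v z -> y = z.
Proof.
elim: f v y z => /=.
- by move=> ? v y z -> ->.
- by move=> v y z -> ->.
- by move=> ? i v y z -> ->.
- move=> k' m f IHf g IHg v y z [w gw fw] [w' gw' fw'].
  suff ww' : w = w' by subst w'; apply: IHf fw fw'.
  by apply: eq_from_tnth => i; apply: IHg (gw i) (gw' i).
- move=> k' f IHf g IHg v; elim: (thead v) => [|n IHn] y z /=.
    exact: IHf.
  move=> [t pt gt] [t' pt' gt'].
  by have tt' := IHn _ _ pt pt'; subst t'; apply: IHg gt gt'.
- move=> k' f IHf v y z [fy ly] [fz lz].
  case: (ltngtP y z) => // [yz|zy].
    by have [t ft] := lz _ yz; have := IHf _ _ _ fy ft.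
  by have [t ft] := ly _ zy; have := IHf _ _ _ fz ft.
Qed.

(** Total functions are represented on infinite environments [e], of which only
    the first [k] values are read.  Unlike for tuples, dropping the values bound
    by a binder is then convertible to a shift of indices, so that the lemmas
    for recursion, sums and quantifiers apply by unification. *)
Definition env_tuple k (e : nat -> nat) : k.-tuple nat := [tuple e i | i < k].

Definition scons (x : nat) (e : nat -> nat) (i : nat) : nat :=
  if i is j.+1 then e j else x.

Definition total_rec k (F : (nat -> nat) -> nat) : Prop :=
  exists c : recfun k, forall e, rf_eval c (env_tuple k e) (F e).

Lemma cons_env_tuple k x e :
  cons_tuple x (env_tuple k e) = env_tuple k.+1 (scons x e).
Proof.
apply: eq_from_tnth => i; rewrite tnth_mktuple.
case: (unliftP ord0 i) => [j|] ->; last by [].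
by rewrite /= tnthS tnth_mktuple.
Qed.

Lemma total_rec_ext {k F G} : F =1 G -> total_rec k F -> total_rec k G.
Proof. by move=> FG [c Hc]; exists c => e; rewrite -FG. Qed.

Lemma total_rec_comp {k m} {F : (nat -> nat) -> nat}
    {H : nat -> (nat -> nat) -> nat} :
  total_rec m F -> (forall i, i < m -> total_rec k (H i)) ->
  total_rec k (fun e => F (fun i => H i e)).
Proof.
move=> [c cP] hH.
have {hH} /choice[g gP] : forall i : 'I_m,
   exists d : recfun k, forall e, rf_eval d (env_tuple k e) (H i e).
  by move=> i; apply: hH.
exists (rf_comp c g) => e /=; exists (env_tuple m (fun i => H i e)) => // i.
by rewrite tnth_mktuple.
Qed.

Lemma total_rec_var {k} i : i < k -> total_rec k (fun e => e i).
Proof.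
by move=> ik; exists (rf_proj (Ordinal ik)) => e /=; rewrite tnth_mktuple.
Qed.

Lemma total_rec_app1 {k} (f : nat -> nat) {A} :
  total_rec 1 (fun e => f (e 0)) -> total_rec k A ->
  total_rec k (fun e => f (A e)).
Proof.
move=> hf hA.
exact: (total_rec_comp (H := fun _ => A) hf (fun i _ => hA)).
Qed.

Lemma total_rec_app2 {k} (f : nat -> nat -> nat) {A B} :
  total_rec 2 (fun e => f (e 0) (e 1)) -> total_rec k A -> total_rec k B ->
  total_rec k (fun e => f (A e) (B e)).
Proof.
move=> hf hA hB.
apply: (total_rec_comp (H := fun i => if i is 0 then A else B) hf).
by case.
Qed.

Lemma total_rec_succ {k} {A} :
  total_rec k A -> total_rec k (fun e => (A e).+1).
Proof.
apply: (total_rec_app1 S); exists rf_succ => e /=.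
by rewrite /thead tnth_mktuple.
Qed.

Lemma total_rec_const {k} n : total_rec k (fun=> n).
Proof.
by elim: n => [|n IHn]; [exists (rf_zero k)|apply: total_rec_succ].
Qed.

(** In the step [G], index [0] is the counter, index [1] the previous value, and
    the ambient environment starts at index [2]. *)
Lemma total_rec_nat_rect {k} {N A : (nat -> nat) -> nat}
    {G : nat -> nat -> (nat -> nat) -> nat} :
  total_rec k.+2 (fun e => G (e 0) (e 1) (fun i => e i.+2)) ->
  total_rec k A -> total_rec k N ->
  total_rec k (fun e => nat_rect (fun=> nat) (A e) (fun n z => G n z e) (N e)).
Proof.
move=> [g gP] [a aP] hN.
(* [rf_prec] recurses on its first argument: run it with the bound [N e] in
   front of the environment. *)
pose F e := nat_rect (fun=> nat) (A (fun i => e i.+1))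
              (fun n z => G n z (fun i => e i.+1)) (e 0).
have hF : total_rec k.+1 F.
  exists (rf_prec a g) => e.
  have -> : env_tuple k.+1 e = cons_tuple (e 0) (env_tuple k (fun i => e i.+1)).
    rewrite cons_env_tuple; apply: eq_from_tnth => i.
    by rewrite !tnth_mktuple; case: (nat_of_ord i).
  rewrite /= theadE /F; have -> : behead_tuple (cons_tuple (e 0)
      (env_tuple k (fun i => e i.+1))) = env_tuple k (fun i => e i.+1).
    exact: val_inj.
  elim: (e 0) => [|n IHn] /=.
    exact: aP.
  exists (nat_rect (fun=> nat) (A (fun i => e i.+1))
              (fun n z => G n z (fun i => e i.+1)) n) => //.
  by rewrite !cons_env_tuple; apply: gP.
apply: (total_rec_comp
  (H := fun i => if i is j.+1 then fun e => e j else N) hF).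
by case=> // i; rewrite ltnS; exact: total_rec_var.
Qed.

Lemma total_rec_add {k} {A B} : total_rec k A -> total_rec k B ->
  total_rec k (fun e => A e + B e).
Proof.
apply: (total_rec_app2 addn).
apply: (total_rec_ext (F := fun e =>
  nat_rect (fun=> nat) (e 0) (fun _ z => z.+1) (e 1))).
  by move=> e; elim: (e 1) => [|n /= ->]; rewrite ?addn0 ?addnS.
apply: (total_rec_nat_rect (G := fun _ z _ => z.+1)).
- exact/total_rec_succ/total_rec_var.
- exact: total_rec_var.
- exact: total_rec_var.
Qed.

Lemma total_rec_sum {k} {N} {G : nat -> (nat -> nat) -> nat} :
  total_rec k.+1 (fun e => G (e 0) (fun i => e i.+1)) -> total_rec k N ->
  total_rec k (fun e => \sum_(i < N e) G i e).
Proof.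
move=> hG hN; apply: (total_rec_ext (F := fun e =>
  nat_rect (fun=> nat) 0 (fun n z => z + G n e) (N e))).
  by move=> e; elim: (N e) => [|n /= ->]; rewrite ?big_ord0 ?big_ord_recr.
apply: (total_rec_nat_rect (G := fun n z e => z + G n e) _
  (total_rec_const 0) hN).
apply: total_rec_add; first exact: total_rec_var.
apply: (total_rec_comp (H := fun i e => if i is j.+1 then e j.+2 else e 0) hG).
by case=> [_|i ik]; exact: total_rec_var.
Qed.

Lemma total_rec_mul {k} {A B} : total_rec k A -> total_rec k B ->
  total_rec k (fun e => A e * B e).
Proof.
apply: (total_rec_app2 muln).
apply: (total_rec_ext (F := fun e => \sum_(i < e 0) e 1)).
  by move=> e; rewrite sum_nat_const card_ord.
by apply: (total_rec_sum (G := fun _ e => e 1)); exact: total_rec_var.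
Qed.

Lemma total_rec_prod {k} {N} {G : nat -> (nat -> nat) -> nat} :
  total_rec k.+1 (fun e => G (e 0) (fun i => e i.+1)) -> total_rec k N ->
  total_rec k (fun e => \prod_(i < N e) G i e).
Proof.
move=> hG hN; apply: (total_rec_ext (F := fun e =>
  nat_rect (fun=> nat) 1 (fun n z => z * G n e) (N e))).
  by move=> e; elim: (N e) => [|n /= ->]; rewrite ?big_ord0 ?big_ord_recr.
apply: (total_rec_nat_rect (G := fun n z e => z * G n e) _
  (total_rec_const 1) hN).
apply: total_rec_mul; first exact: total_rec_var.
apply: (total_rec_comp (H := fun i e => if i is j.+1 then e j.+2 else e 0) hG).
by case=> [_|i ik]; exact: total_rec_var.
Qed.

Lemma total_rec_exp {k} b {A} : total_rec k A -> total_rec k (fun e => b ^ A e).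
Proof.
apply: (total_rec_app1 (expn b)).
apply: (total_rec_ext (F := fun e => \prod_(i < e 0) b)).
  by move=> e; rewrite prod_nat_const card_ord.
by apply: total_rec_prod; [exact: total_rec_const|exact: total_rec_var].
Qed.

Lemma total_rec_sub {k} {A B} : total_rec k A -> total_rec k B ->
  total_rec k (fun e => A e - B e).
Proof.
apply: (total_rec_app2 subn).
apply: (total_rec_ext (F := fun e =>
  nat_rect (fun=> nat) (e 0) (fun _ z => z.-1) (e 1))).
  by move=> e; elim: (e 1) => [|n /= ->]; rewrite ?subn0 ?subnS.
apply: (total_rec_nat_rect (G := fun _ z _ => z.-1));
  try exact: total_rec_var.
apply: (total_rec_app1 predn); last exact: total_rec_var.
apply: (total_rec_ext (F := fun e =>
  nat_rect (fun=> nat) 0 (fun n _ => n) (e 0))).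
  by move=> e; case: (e 0).
by apply: (total_rec_nat_rect (G := fun n _ _ => n)); exact: total_rec_var
  || exact: total_rec_const.
Qed.

Definition decidable_rec k (P : (nat -> nat) -> bool) : Prop :=
  total_rec k (fun e => P e : nat).

Lemma decidable_rec_leq {k} {A B} : total_rec k A -> total_rec k B ->
  decidable_rec k (fun e => A e <= B e).
Proof.
move=> hA hB; apply: (total_rec_ext (F := fun e => 1 - (A e - B e))).
  by move=> e; rewrite -subn_eq0; case: (A e - B e).
by apply: total_rec_sub; [exact: total_rec_const|exact: total_rec_sub].
Qed.

Lemma decidable_rec_and {k} {P Q} : decidable_rec k P -> decidable_rec k Q ->
  decidable_rec k (fun e => P e && Q e).
Proof.
move=> hP hQ; apply: (total_rec_ext (F := fun e => P e * Q e)).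
  by move=> e; rewrite mulnb.
exact: total_rec_mul.
Qed.

Lemma decidable_rec_neg {k} {P} : decidable_rec k P ->
  decidable_rec k (fun e => ~~ P e).
Proof.
move=> hP; apply: (total_rec_ext (F := fun e => 1 - P e)).
  by move=> e; case: (P e).
by apply: total_rec_sub => //; exact: total_rec_const.
Qed.

Lemma decidable_rec_eq {k} {A B} : total_rec k A -> total_rec k B ->
  decidable_rec k (fun e => A e == B e).
Proof.
move=> hA hB.
apply: (total_rec_ext (F := fun e => (A e <= B e) && (B e <= A e))).
  by move=> e; rewrite eqn_leq.
by apply: decidable_rec_and; exact: decidable_rec_leq.
Qed.

Lemma decidable_rec_all {k} {N} {P : nat -> (nat -> nat) -> bool} :
  decidable_rec k.+1 (fun e => P (e 0) (fun i => e i.+1)) -> total_rec k N ->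
  decidable_rec k (fun e => all (P ^~ e) (iota 0 (N e))).
Proof.
move=> hP hN; apply: (total_rec_ext (F := fun e => \prod_(i < N e) P i e)).
  move=> e; elim: (N e) => [|n IHn]; first by rewrite big_ord0.
  by rewrite -(addn1 n) iotaD all_cat addn1 big_ord_recr /= IHn andbT mulnb.
exact: (total_rec_prod (G := fun i e => P i e)).
Qed.

Lemma decidable_rec_has {k} {N} {P : nat -> (nat -> nat) -> bool} :
  decidable_rec k.+1 (fun e => P (e 0) (fun i => e i.+1)) -> total_rec k N ->
  decidable_rec k (fun e => has (P ^~ e) (iota 0 (N e))).
Proof.
move=> hP hN; apply: (total_rec_ext
    (F := fun e => ~~ all (fun i => ~~ P i e) (iota 0 (N e)))).
  by move=> e; rewrite -has_predC; congr nat_of_bool; apply: eq_has => i /=;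
    rewrite negbK.
apply: decidable_rec_neg.
apply: (decidable_rec_all (P := fun i e => ~~ P i e)) => //.
exact: decidable_rec_neg.
Qed.

Lemma sum_ord_ltn n q : \sum_(i < n) (i < q) = minn q n.
Proof.
by elim: n => [|n IHn]; rewrite ?big_ord0 ?big_ord_recr /= ?IHn; lia.
Qed.

Lemma total_rec_div {k} {A B} : total_rec k A -> total_rec k B ->
  total_rec k (fun e => A e %/ B e).
Proof.
apply: (total_rec_app2 divn).
apply: (total_rec_ext (F := fun e =>
    \sum_(i < e 0) ((i.+1 * e 1 <= e 0) && (1 <= e 1)))).
  move=> e; case: (posnP (e 1)) => [->|e1].
    by rewrite divn0 big1 // => i _; rewrite andbF.
  under eq_bigr do rewrite andbT -leq_divRL //.
  by rewrite sum_ord_ltn; apply/minn_idPl/leq_div.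
apply: (total_rec_sum (G := fun i e => (i.+1 * e 1 <= e 0) && (1 <= e 1)));
  last exact: total_rec_var.
apply: decidable_rec_and; apply: decidable_rec_leq; try exact: total_rec_var.
  by apply: total_rec_mul; [apply: total_rec_succ|]; exact: total_rec_var.
exact: total_rec_const.
Qed.

Lemma decidable_rec_odd {k} {A} : total_rec k A ->
  decidable_rec k (fun e => odd (A e)).
Proof.
move=> hA; apply: (total_rec_ext (F := fun e => A e - A e %/ 2 * 2)).
  by move=> e; rewrite {1}(divn_eq (A e) 2) modn2 addKn.
apply: total_rec_sub => //; apply: total_rec_mul; last exact: total_rec_const.
by apply: total_rec_div => //; exact: total_rec_const.
Qed.

(** With [str_code] this computes the length of a string from its code, see
    [trunc_log_str_code]. *)
Lemma total_rec_trunc_log2 {k} {A} : total_rec k A ->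
  total_rec k (fun e => trunc_log 2 (A e).+1).
Proof.
apply: (total_rec_app1 (fun a => trunc_log 2 a.+1)).
apply: (total_rec_ext (F := fun e => \sum_(i < e 0) (2 ^ i.+1 <= (e 0).+1))).
  move=> e; set y := e 0.
  have le2y n : (2 ^ n <= y.+1) = (n <= trunc_log 2 y.+1).
    apply/idP/idP; first exact: trunc_log_max.
    move=> nl; apply: leq_trans (trunc_logP (isT : 1 < 2) (ltn0Sn y)).
    by rewrite leq_exp2l.
  under eq_bigr do rewrite le2y.
  rewrite sum_ord_ltn; apply/minn_idPl; rewrite -ltnS.
  by apply: leq_trans (trunc_logP (isT : 1 < 2) (ltn0Sn y)); rewrite ltn_expl.
apply: (total_rec_sum (G := fun i e => 2 ^ i.+1 <= (e 0).+1)).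
  apply: decidable_rec_leq; last exact/total_rec_succ/total_rec_var.
  exact/total_rec_exp/total_rec_succ/total_rec_var.
exact: total_rec_var.
Qed.

Lemma computable2_total_rec {f} : computable2 f ->
  total_rec 2 (fun e => f (e 0) (e 1)).
Proof.
move=> [c cP]; exists c => e.
suff -> : env_tuple 2 e = [tuple e 0; e 1] by [].
by apply: eq_from_tnth => i; rewrite tnth_mktuple; case: i => -[|[|]].
Qed.


(** * Strings and machines given by their graph *)

Lemma str_code_inj : injective str_code.
Proof.
elim=> [|b s IHs] [|b' s'] //= [] e.
have [-> /IHs-> //] : b = b' /\ str_code s = str_code s'.
by split; move: e; case: b b' => -[]; lia.
Qed.

Lemma str_code_surj n : exists s, str_code s == n.
Proof.
elim/ltn_ind: n => -[|n] IHn; first by exists [::].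
have [|s /eqP sn] := IHn n./2; first lia.
by exists (odd n :: s); rewrite /= sn addnC odd_double_half.
Qed.

Definition str_decode n : bitseq := xchoose (str_code_surj n).

Lemma str_decodeK : cancel str_decode str_code.
Proof. by move=> n; apply/eqP/(xchooseP (str_code_surj n)). Qed.

Lemma str_codeK : cancel str_code str_decode.
Proof. by move=> s; apply: str_code_inj; rewrite str_decodeK. Qed.

(** Since [M] is single-valued, an input has at most one output satisfying the
    decidable predicate [P], and minimization finds exactly that one. *)
Lemma computable_machine_graph (M : machine) (P : nat -> nat -> bool) :
  decidable_rec 2 (fun e => P (e 1) (e 0)) ->
  (forall p x, M p = Some x <-> P (str_code p) (str_code x)) ->
  computable_machine M.
Proof.
move=> /decidable_rec_neg[c cP] MP; exists (rf_mu c) => p y.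
have evalc z :
    rf_eval c (cons_tuple z [tuple str_code p]) (~~ P (str_code p) z).
  have -> : cons_tuple z [tuple str_code p] =
      env_tuple 2 (scons z (fun=> str_code p)).
    by apply: eq_from_tnth => i; rewrite tnth_mktuple; case: i => -[|[|]].
  exact: cP.
split=> /= [[evy _]|[x Mx ->]].
  exists (str_decode y); last by rewrite str_decodeK.
  apply/MP; rewrite str_decodeK.
  by have := rf_eval_inj _ _ _ _ _ (evalc y) evy; case: (P _ _).
split; first by have := evalc (str_code x); rewrite (MP p x).1.
move=> i ix; exists 0; have := evalc i.
suff /negbTE -> : ~~ P (str_code p) i by [].
apply/negP; rewrite -(str_decodeK i) => /MP; rewrite Mx => -[xi].
by move: ix; rewrite xi str_decodeK ltnn.
Qed.

(** The words of length [n], extended on the right: the direction in which time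
    runs along a sequence. *)
Fixpoint words n : seq bitseq :=
  if n is m.+1 then [seq rcons s b | s <- words m, b <- [:: false; true]]
  else [:: [::]].

Lemma big_words_recr {T} {idx : T} (op : Monoid.com_law idx) n F :
  \big[op/idx]_(s <- words n.+1) F s =
  \big[op/idx]_(s <- words n) op (F (rcons s false)) (F (rcons s true)).
Proof.
rewrite big_allpairs_dep /=; apply: eq_bigr => s _.
by rewrite big_cons big_seq1.
Qed.

Lemma str_code_rcons s b :
  str_code (rcons s b) = str_code s + 2 ^ size s * b.+1.
Proof.
elim: s => [|a s IHs] /=; first by rewrite mul1n add0n.
by rewrite IHs expnS; lia.
Qed.

Lemma size_words n s : s \in words n -> size s = n.
Proof.
elim: n s => [|n IHn] s; first by rewrite inE => /eqP->.
by move=> /allpairsP[[t b] [/= /IHn tn _ ->]]; rewrite size_rcons tn.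
Qed.

(** [(str_code s).+1] is the number written in binary as the bits of [s], the
    first one being the least significant, below a leading [1]. *)
Lemma str_code_bounds s : 2 ^ size s <= (str_code s).+1 < 2 ^ (size s).+1.
Proof. by elim: s => //= b s; rewrite !expnS; case: b; lia. Qed.

Lemma trunc_log_str_code s : trunc_log 2 (str_code s).+1 = size s.
Proof. exact/trunc_log_eq/str_code_bounds. Qed.

(** The codes of the words of length [n] are the [2 ^ n] numbers starting from
    [2 ^ n - 1]. *)
Lemma sum_words n (F : nat -> nat) :
  \sum_(s <- words n) F (str_code s) = \sum_(i < 2 ^ n) F (2 ^ n - 1 + i).
Proof.
elim: n F => [|n IHn] F; first by rewrite big_seq1 big_ord1.
rewrite big_words_recr /=.
rewrite (eq_big_seq
  (fun s => F (str_code s + 2 ^ n) + F (str_code s + 2 ^ n.+1))).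
  rewrite (IHn (fun y => F (y + 2 ^ n) + F (y + 2 ^ n.+1))).
  rewrite big_split /= -!(big_mkord xpredT (fun i => F (2 ^ n - 1 + i + _))).
  rewrite -(big_mkord xpredT (fun i => F (2 ^ n.+1 - 1 + i))).
  have n0 : 0 < 2 ^ n by rewrite expn_gt0.
  rewrite (@big_cat_nat _ _ _ (2 ^ n) 0 (2 ^ n.+1)) //=;
    last by rewrite expnS; lia.
  congr (_ + _); first by apply: eq_bigr => i _; congr F; rewrite expnS; lia.
  have shift := big_addn 0 (2 ^ n.+1) (2 ^ n) xpredT
    (fun i => F (2 ^ n.+1 - 1 + i)); rewrite add0n in shift; rewrite {}shift.
  have -> : 2 ^ n.+1 - 2 ^ n = 2 ^ n by rewrite expnS; lia.
  by apply: eq_bigr => i _; congr F; rewrite expnS; lia.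
move=> s /size_words sn; rewrite !str_code_rcons sn muln1.
by rewrite expnS mulnC.
Qed.

Lemma str_code_nseq_cat m s :
  (str_code (nseq m false ++ s)).+1 = 2 ^ m * (str_code s).+1.
Proof. by elim: m => [|m /= IHm]; rewrite ?mul1n // expnS; lia. Qed.

Lemma prefix_nseq_true m m' w w' :
  prefix (nseq m false ++ true :: w) (nseq m' false ++ true :: w') ->
  m = m' /\ prefix w w'.
Proof.
by elim: m m' => [|m IHm] [|m'] //= /IHm[-> ->].
Qed.

(** * Compressing the members of a thin decidable set *)

Section Compressor.

(* A set of strings, given by their codes. *)
Context (A : pred nat).

Definition level_count n i := \sum_(j < i) A (2 ^ n - 1 + j).

Definition rank x :=
  let n := trunc_log 2 x.+1 in level_count n (x - (2 ^ n - 1)).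

Definition sparse m n := level_count n (2 ^ n) * 4 ^ m <= 2 ^ n.

(** The program for [x] is [0^m 1 w] where [w] is the rank of [x], written with
    [n - 2 * m] bits, and [n] is the least length at which [A] is [m]-sparse.
    The last condition states this as an equation between codes; the bound on
    [m] is harmless since the code [p] is at least the length of the program.
    The readable form is [compressorP]. *)
Definition compressor (p x : nat) : bool :=
  let n := trunc_log 2 x.+1 in
  A x && has (fun m => [&& sparse m n,
    all (fun j => ~~ sparse m j) (iota 0 n) &
    p.+1 == 2 ^ m * (2 * (2 ^ (n - 2 * m) + rank x)).+1]) (iota 0 p.+1).

Lemma level_count_lt n i j : i < j -> A (2 ^ n - 1 + i) ->
  level_count n i < level_count n j.
Proof.
move=> ij Si; rewrite /level_count -(subnKC ij) big_split_ord /=.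
by rewrite big_ord_recr /= Si addn1 leq_addr.
Qed.

Lemma rank_str_code x :
  rank (str_code x) = level_count (size x) (str_code x - (2 ^ size x - 1)).
Proof. by rewrite /rank trunc_log_str_code. Qed.

Lemma rank_lt x : A (str_code x) ->
  rank (str_code x) < level_count (size x) (2 ^ size x).
Proof.
move=> Ax; rewrite rank_str_code; have := str_code_bounds x; rewrite expnS => b.
by apply: level_count_lt; [lia|rewrite subnKC //; lia].
Qed.

Lemma rank_mono x y : A (str_code x) -> size x = size y ->
  str_code x < str_code y -> rank (str_code x) < rank (str_code y).
Proof.
move=> Ax xy lt; have := str_code_bounds x; rewrite !rank_str_code xy => b.
by apply: level_count_lt; [lia|rewrite subnKC //; lia].
Qed.

Lemma rank_inj x y : A (str_code x) -> A (str_code y) -> size x = size y ->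
  rank (str_code x) = rank (str_code y) -> x = y.
Proof.
move=> Ax Ay xy rxy; apply: str_code_inj.
have [lt|lt|//] := ltngtP (str_code x) (str_code y).
  by have := rank_mono _ _ Ax xy lt; rewrite rxy ltnn.
by have := rank_mono _ _ Ay (esym xy) lt; rewrite rxy ltnn.
Qed.

(** Among the [2 ^ n] words, at most [2 ^ (n - 2 * m)] are in [A], so that
    [n - 2 * m] bits are enough for the rank. *)
Lemma sparse_rank_word m x : A (str_code x) -> sparse m (size x) ->
  2 * m <= size x /\ exists2 w, size w = size x - 2 * m &
    (str_code w).+1 = 2 ^ size w + rank (str_code x).
Proof.
move=> Ax; rewrite /sparse -[4 ^ m](expnM 2 2 m) => sp; have rx := rank_lt _ Ax.
have mx : 2 * m <= size x.
  rewrite -(leq_exp2l _ _ (isT : 1 < 2)); apply: leq_trans sp.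
  by rewrite leq_pmull //; exact: leq_ltn_trans rx.
have rm : rank (str_code x) < 2 ^ (size x - 2 * m).
  apply: leq_trans rx _.
  by rewrite -(@leq_pmul2r (2 ^ (2 * m))) ?expn_gt0 // -expnD (subnK mx).
split=> //; pose w := str_decode (2 ^ (size x - 2 * m) + rank (str_code x) - 1).
have wE : (str_code w).+1 = 2 ^ (size x - 2 * m) + rank (str_code x).
  by rewrite str_decodeK; have := expn_gt0 2 (size x - 2 * m); lia.
have sw : size w = size x - 2 * m.
  rewrite -trunc_log_str_code wE; apply: trunc_log_eq => //.
  by rewrite expnS; lia.
by exists w => //; rewrite sw.
Qed.

Lemma compressorP p x :
  compressor (str_code p) (str_code x) <->
  [/\ A (str_code x) & exists m w, [/\ sparse m (size x),
    forall j, j < size x -> ~~ sparse m j, size w + 2 * m = size x,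
    (str_code w).+1 = 2 ^ size w + rank (str_code x) &
    p = nseq m false ++ true :: w]].
Proof.
rewrite /compressor trunc_log_str_code; split.
  move=> /andP[Ax /hasP[m _ /and3P[sp /allP mn /eqP pE]]]; split => //.
  have [mx [w sw wE]] := sparse_rank_word m x Ax sp.
  exists m, w; split => //.
  - by move=> j jx; apply: mn; rewrite mem_iota.
  - by rewrite sw subnK.
  - apply: str_code_inj; apply: succn_inj.
    by rewrite str_code_nseq_cat pE -sw -wE /=; congr (_ * _); lia.
move=> [Ax [m [w [sp mn sw wE pE]]]]; rewrite Ax andTb.
have pE' : (str_code p).+1 =
    2 ^ m * (2 * (2 ^ (size x - 2 * m) + rank (str_code x))).+1.
  rewrite pE str_code_nseq_cat; congr (_ * _).
  by rewrite -sw addnK -wE /=; lia.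
apply/hasP; exists m; last first.
  rewrite sp pE' eqxx andbT; apply/allP => j; rewrite mem_iota; exact: mn.
rewrite mem_iota /= pE' add0n; apply: leq_trans (ltn_expl m (isT : 1 < 2)) _.
exact: leq_pmulr.
Qed.

(** The block [0^m 1] delimits itself and [m] determines the length of the rest
    of the program.  For [p = q] the lemma says that the machine is
    single-valued. *)
Lemma compressor_prefix p q x y :
  compressor (str_code p) (str_code x) ->
  compressor (str_code q) (str_code y) -> prefix p q -> p = q /\ x = y.
Proof.
move=> /compressorP[Ax [m [w [sx mx wx cx ->]]]].
move=> /compressorP[Ay [m' [w' [sy my wy cy ->]]]] /prefix_nseq_true[mm].
subst m' => /prefixP[t w't].
have xy : size x = size y.
  case: (ltngtP (size x) (size y)) => // [/my|/mx]; first by rewrite sx.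
  by rewrite sy.
have t0 : size t = 0.
  apply/eqP; rewrite -(eqn_add2l (size w)) addn0 -size_cat -w't.
  by rewrite -(eqn_add2r (2 * m)) wy wx xy.
have ww : w' = w by rewrite w't (size0nil t0) cats0.
subst w'; rewrite ww in cy *; split => //.
by apply: rank_inj => //; move: cy cx; lia.
Qed.

Definition compressor_machine : machine := fun p =>
  if pselect (exists x, compressor (str_code p) (str_code x)) is left h
  then Some (projT1 (cid h)) else None.

Lemma compressor_machineP p x : compressor_machine p = Some x <->
  compressor (str_code p) (str_code x).
Proof.
rewrite /compressor_machine; case: pselect => [h|nh]; last first.
  by split=> // cx; case: nh; exists x.
case: cid => y cy /=; split=> [[<-] //|cx].
by have [_ ->] := compressor_prefix _ _ _ _ cy cx (prefix_refl _).
Qed.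

Context (A_decidable : decidable_rec 1 (fun e => A (e 0))).

Lemma total_rec_level_count {k N I} : total_rec k N -> total_rec k I ->
  total_rec k (fun e => level_count (N e) (I e)).
Proof.
apply: (total_rec_app2 level_count).
apply: (total_rec_sum (G := fun j e => A (2 ^ e 0 - 1 + j)));
  last exact: total_rec_var.
apply: (total_rec_app1 (fun x => nat_of_bool (A x))) => //.
apply: total_rec_add; last exact: total_rec_var.
apply: total_rec_sub; last exact: total_rec_const.
exact/total_rec_exp/total_rec_var.
Qed.

Lemma decidable_rec_sparse {k m n} : total_rec k m -> total_rec k n ->
  decidable_rec k (fun e => sparse (m e) (n e)).
Proof.
move=> hm hn; have h2 := total_rec_exp 2 hn.
apply: decidable_rec_leq => //; apply: total_rec_mul; last exact: total_rec_exp.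
exact: total_rec_level_count.
Qed.

Lemma total_rec_rank {k x} : total_rec k x -> total_rec k (fun e => rank (x e)).
Proof.
move=> hx; have hl := total_rec_trunc_log2 hx.
apply: total_rec_level_count => //; apply: total_rec_sub => //.
apply: total_rec_sub; last exact: total_rec_const.
exact: total_rec_exp.
Qed.

Lemma compressor_machine_prefix : prefix_machine compressor_machine.
Proof.
split; last first.
  move=> p q; case Mp : compressor_machine => [x|//] _.
  case Mq : compressor_machine => [y|//] _.
  move/compressor_machineP : Mp => cp; move/compressor_machineP : Mq => cq.
  by case/(compressor_prefix _ _ _ _ cp cq).
apply: (computable_machine_graph _ compressor) => [|p x];
  last exact: compressor_machineP.
apply: decidable_rec_and.
  apply: (total_rec_app1 (fun x => nat_of_bool (A x))) => //.
  exact: total_rec_var.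
apply: (decidable_rec_has (P := fun m e => [&& sparse m (trunc_log 2 (e 0).+1),
    all (fun j => ~~ sparse m j) (iota 0 (trunc_log 2 (e 0).+1)) &
    (e 1).+1 ==
      2 ^ m * (2 * (2 ^ (trunc_log 2 (e 0).+1 - 2 * m) + rank (e 0))).+1]));
  last exact/total_rec_succ/total_rec_var.
have hl : total_rec 3 (fun e => trunc_log 2 (e 1).+1).
  exact/total_rec_trunc_log2/total_rec_var.
have hd k B : total_rec k B -> total_rec k (fun e => 2 * B e).
  by move=> ?; apply: total_rec_mul => //; exact: total_rec_const.
apply: decidable_rec_and.
  by apply: decidable_rec_sparse => //; exact: total_rec_var.
apply: decidable_rec_and.
  apply: (decidable_rec_all (P := fun j e => ~~ sparse (e 0) j)) => //.
  apply: decidable_rec_neg.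
  by apply: decidable_rec_sparse; exact: total_rec_var.
apply: decidable_rec_eq; first exact/total_rec_succ/total_rec_var.
apply: total_rec_mul; first exact/total_rec_exp/total_rec_var.
apply/total_rec_succ/hd/total_rec_add; last exact/total_rec_rank/total_rec_var.
by apply/total_rec_exp/total_rec_sub => //; exact/hd/total_rec_var.
Qed.

End Compressor.

Lemma K_le (U : machine) q x : U q = Some x -> K U x <= size q.
Proof.
move=> Uq; rewrite /K; case: xgetP => [n _ [_ nmin]|none].
  by apply: nmin; exists q.
by [].
Qed.

(** A program for the initial segment of length [n] has [n - m + 1] bits:
    [2 * m] are saved on the rank and [m + 1] are spent to announce [m].  Taking
    [m] larger than the two constants, of randomness and of simulation by [U],
    is a contradiction. *)
Lemma thin_not_KC (U : machine) (P : pred bitseq) (alpha : nat -> bool) :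
  universal_prefix_machine U ->
  decidable_rec 1 (fun e => P (str_decode (e 0))) ->
  (forall m, exists n, count P (words n) * 4 ^ m <= 2 ^ n) ->
  (forall n, P (mkseq alpha n)) ->
  ~ KC U alpha.
Proof.
move=> [_ Umin] Pdec thin Palpha [k Kalpha].
pose A y := P (str_decode y).
have countE n : level_count A n (2 ^ n) = count P (words n).
  rewrite /level_count -(sum_words n (fun y => A y : nat)) -sum1_count.
  rewrite [RHS]big_mkcond /=; apply: eq_bigr => s _.
  by rewrite /A str_codeK; case: (P s).
have [c cP] := Umin _ (compressor_machine_prefix A Pdec).
(* It suffices that [m - 1] exceeds [k + c]. *)
pose m := k + c + 2.
have ex : exists n, sparse A m n.
  by have [n] := thin m; rewrite -countE => ?; exists n.
case: (ex_minnP ex) => n spn minn.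
pose x := mkseq alpha n.
have sx : size x = n by rewrite size_mkseq.
have Ax : A (str_code x) by rewrite /A str_codeK; exact: Palpha.
have [|mn [w sw wE]] := sparse_rank_word A m x Ax; first by rewrite sx.
pose p := nseq m false ++ true :: w.
have Mp : compressor_machine A p = Some x.
  apply/compressor_machineP/compressorP; split => //; exists m, w.
  split; rewrite ?sx ?sw ?subnK //; last by rewrite -sw.
  by move=> j; rewrite ltnNge; apply: contra => /minn.
have [q Uq] := cP _ _ Mp; rewrite size_cat size_nseq /= sw sx => qp.
have := leq_trans (Kalpha n) (leq_trans (K_le _ _ _ Uq) qp).
by rewrite /m; move: mn; rewrite sx /m; lia.
Qed.

Local Open Scope ring_scope.

(** * Walks with given step lengths *)

Section Walk.
Context {R : realType}.
Implicit Types (v : R^nat) (c : R).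

Definition walk v (s : bitseq) : R :=
  \sum_(j < size s) sgn_bit R (nth false s j) * v j.

Definition confined c v (s : bitseq) : bool :=
  all (fun k => `|walk v (take k s)| <= c) (iota 0 (size s).+1).

Lemma walk_rcons v s b :
  walk v (rcons s b) = walk v s + sgn_bit R b * v (size s).
Proof.
rewrite /walk size_rcons big_ord_recr /= nth_rcons ltnn eqxx.
by congr (_ + _); apply: eq_bigr => j _; rewrite nth_rcons ltn_ord.
Qed.

Lemma confined_rcons c v s b :
  confined c v (rcons s b) = confined c v s && (`|walk v (rcons s b)| <= c).
Proof.
rewrite /confined size_rcons -[in LHS]addn1 iotaD all_cat add0n all_seq1.
rewrite -{2}(size_rcons s b) take_size; congr (_ && _).
apply: eq_in_all => k; rewrite mem_iota ltnS => /andP[_ ks].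
by rewrite -cats1 takel_cat.
Qed.

(** The parallelogram law is the only probabilistic input: a fair sign adds
    [v ^+ 2] to the mean square. *)
Lemma sqr_walk_rcons v s :
  walk v (rcons s false) ^+ 2 + walk v (rcons s true) ^+ 2 =
  2 * walk v s ^+ 2 + 2 * v (size s) ^+ 2.
Proof. rewrite !walk_rcons /sgn_bit; ring. Qed.

Lemma norm_sgn_bit b : `|sgn_bit R b| = 1.
Proof. by case: b; rewrite /sgn_bit ?normrN normr1. Qed.

Lemma confined_walk c v s : confined c v s -> `|walk v s| <= c.
Proof.
by move=> /allP/(_ (size s)); rewrite take_size mem_iota leqnn; exact.
Qed.

(** A stopping time argument, multiplied by [2 ^+ n]: with [N k] the number of
    confined words of length [k] and [L] a bound for the square of the walk up
    to and including its first exit, [Phi k] is the sum over all words of the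
    square of the stopped walk, minus [2 ^+ k * L], where words stopped before
    are counted as if they had reached [L].  Each step makes [Phi] grow by at
    least [2 * N k * v k ^+ 2] beyond doubling, yet [Phi] is never positive. *)
Lemma confined_energy c B v n : (forall j, `|v j| <= B) ->
  (count (confined c v) (words n))%:R * (\sum_(j < n) v j ^+ 2) <=
  2 ^+ n * (c + B) ^+ 2.
Proof.
move=> vB; set L := (c + B) ^+ 2.
pose N k : R := \sum_(s <- words k) (confined c v s)%:R.
pose Phi k : R := \sum_(s <- words k) (confined c v s)%:R * (walk v s ^+ 2 - L).
have NE k : (count (confined c v) (words k))%:R = N k.
  rewrite -sum1_count big_mkcond natr_sum; apply: eq_bigr => s _.
  by case: (confined c v s).
have sqr_le (x : R) : `|x| <= c + B -> x ^+ 2 <= L.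
  by move=> xL; rewrite -(real_normK (num_real x)) lerXn2r ?nnegrE //;
    exact: le_trans xL.
have B0 : 0 <= B := le_trans (normr_ge0 _) (vB 0).
have walkL s b : confined c v s -> walk v (rcons s b) ^+ 2 <= L.
  move=> /confined_walk cs; apply: sqr_le; rewrite walk_rcons.
  by rewrite (le_trans (ler_normD _ _)) // normrM norm_sgn_bit mul1r lerD.
have Phi_le0 k : Phi k <= 0.
  apply: sumr_le0 => s _.
  case: (boolP (confined c v s)) => cs; last by rewrite mul0r.
  rewrite mul1r subr_le0 sqr_le //.
  by apply: (le_trans (confined_walk _ _ _ cs)); rewrite lerDl.
suff Phi_ge k : N k * (\sum_(j < k) v j ^+ 2) - 2 ^+ k * L <= Phi k.
  by rewrite NE -subr_le0; apply: le_trans (Phi_le0 n).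
elim: k => [|k IHk].
  rewrite big_ord0 mulr0 /Phi big_seq1 /walk big_ord0 expr0n /=.
  by have : 0 <= L := sqr_ge0 _; case: (confined _ _ _) => /=; lra.
have N_le : N k.+1 <= 2 * N k.
  rewrite /N big_words_recr mulr_sumr; apply: ler_sum => s _ /=.
  rewrite !confined_rcons; case: (confined c v s) => /=; last by lra.
  case: (`|walk v (rcons s false)| <= c); case: (`|walk v (rcons s true)| <= c)
    => /=; lra.
have Phi_rec : 2 * Phi k + 2 * (N k * v k ^+ 2) <= Phi k.+1.
  rewrite /Phi /N big_words_recr mulr_suml !mulr_sumr -big_split /=.
  rewrite big_seq [leRHS]big_seq; apply: ler_sum => s /size_words sk.
  have := sqr_walk_rcons v s; rewrite sk !confined_rcons.
  case: (boolP (confined c v s)) => /= cs; last by lra.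
  have := walkL _ true cs; have := walkL _ false cs.
  case: (`|walk v (rcons s false)| <= c); case: (`|walk v (rcons s true)| <= c)
    => /=; lra.
rewrite big_ord_recr /=.
have V0 : 0 <= \sum_(j < k) v j ^+ 2 + v k ^+ 2.
  by rewrite addr_ge0 ?sqr_ge0 // sumr_ge0 // => j _; exact: sqr_ge0.
rewrite (exprS 2 k); apply: le_trans Phi_rec.
have := ler_wpM2r V0 N_le; lra.
Qed.

(** Dividing [confined_energy] by the sum of squares, which is as large as
    desired. *)
Lemma confined_thin c B v : (forall j, `|v j| <= B) ->
  (forall A : R, exists n, A <= \sum_(j < n) v j ^+ 2) ->
  forall m, exists n, (count (confined c v) (words n) * 4 ^ m <= 2 ^ n)%N.
Proof.
move=> vB Vinf m; set L := (c + B) ^+ 2.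
have L0 : 0 <= L := sqr_ge0 _.
have [n nV] := Vinf (4 ^+ m * (L + 1)); exists n.
have := confined_energy c B v n vB; rewrite -/L => E.
rewrite -(ler_nat R) natrM !natrX.
have p4 : 0 < 4 ^+ m :> R by rewrite exprn_gt0.
have L1 : 0 < L + 1 by lra.
rewrite -(ler_pM2r L1); apply: (@le_trans _ _ (2 ^+ n * L)); last first.
  by rewrite ler_pM2l ?exprn_gt0 //; lra.
apply: le_trans E; rewrite -mulrA; apply: ler_wpM2l => //.
Qed.
End Walk.

Local Open Scope nat_scope.

(** * Confinement of a rational walk is decidable *)

Lemma odd_str_code s j : j < size s ->
  odd ((str_code s).+1 %/ 2 ^ j) = nth false s j.
Proof.
elim: s j => // b s IHs [|j] /=.
  by rewrite divn1 /= ?negbK oddD odd_double; case: b.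
rewrite ltnS => /IHs <-; rewrite expnS divnMA; congr (odd (_ %/ _)).
by case: b; lia.
Qed.

Section WalkDecidable.
Context {R : realType}.
Context (s a b : nat -> nat).
Context (b0 : forall k, b k != 0).
Context (s_rec : total_rec 1 (fun e => s (e 0)))
  (a_rec : total_rec 1 (fun e => a (e 0)))
  (b_rec : total_rec 1 (fun e => b (e 0))).

Let v : R^nat := fun j => ((-1) ^+ s j * (a j)%:R / (b j)%:R)%R.

Definition walk_den k := \prod_(j < k) b j.

(** Numerators over the common denominator [walk_den k]: the sum of the upward
    steps for [t = 0] and of the absolute values of the downward steps for
    [t = 1].  Keeping them apart avoids negative numbers.  The step [j] goes up
    when the sign bit and the parity of [s j], the exponent of [-1] in [v j],
    add up to an odd number. *)
Definition walk_num t y k := nat_rect (fun=> nat) 0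
  (fun j z => z * b j + odd (y.+1 %/ 2 ^ j + s j + t) * a j * walk_den j) k.

Lemma walk_num_den (x : bitseq) k : k <= size x ->
  ((walk_num 0 (str_code x) k)%:R - (walk_num 1 (str_code x) k)%:R =
   (walk_den k)%:R * walk v (take k x) :> R)%R.
Proof.
elim: k => [|k IHk] kx; first by rewrite take0 /walk big_ord0 mulr0 subrr.
have kx' := ltnW kx; rewrite (take_nth false kx) walk_rcons size_takel //.
rewrite /walk_den big_ord_recr /= -/(walk_den k) !natrD !natrM mulrDr.
have -> : ((walk_den k)%:R * (b k)%:R * walk v (take k x) =
  (b k)%:R * ((walk_num 0 (str_code x) k)%:R -
              (walk_num 1 (str_code x) k)%:R) :> R)%R.
  by rewrite IHk //; ring.
rewrite !oddD odd_str_code //= /v -(signr_odd _ (s k)) /sgn_bit.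
have bk : (b k)%:R != 0%R :> R by rewrite pnatr_eq0.
by case: (nth false x k); case: (odd (s k)) => /=; field.
Qed.

Lemma total_rec_walk_num t : total_rec 2 (fun e => walk_num t (e 0) (e 1)).
Proof.
apply: (total_rec_nat_rect (G := fun j z e =>
  z * b j + odd ((e 0).+1 %/ 2 ^ j + s j + t) * a j * walk_den j));
  last exact: total_rec_var; last exact: total_rec_const.
have hv i : i < 4 -> total_rec 4 (fun e => e i) by exact: total_rec_var.
have h0 := hv 0 isT.
apply: total_rec_add.
  by apply: total_rec_mul; [exact: hv|exact: (total_rec_app1 b)].
apply: total_rec_mul; last first.
  apply: (total_rec_prod (G := fun j _ => b j)) => //.
  by apply: (total_rec_app1 b) => //; exact: total_rec_var.
apply: total_rec_mul; last exact: (total_rec_app1 a).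
apply: decidable_rec_odd; apply: total_rec_add; last exact: total_rec_const.
apply: total_rec_add; last exact: (total_rec_app1 s).
apply: total_rec_div; first exact/total_rec_succ/hv.
exact: total_rec_exp.
Qed.

Lemma confined_decidable c :
  decidable_rec 1 (fun e => confined (c%:R : R)%R v (str_decode (e 0))).
Proof.
pose good y k := (walk_num 0 y k <= walk_num 1 y k + c * walk_den k) &&
                 (walk_num 1 y k <= walk_num 0 y k + c * walk_den k).
apply: (total_rec_ext (F := fun e =>
    all (good (e 0)) (iota 0 (trunc_log 2 (e 0).+1).+1))).
  move=> e; rewrite -{1 2}(str_decodeK (e 0)); set x := str_decode _.
  rewrite trunc_log_str_code; congr nat_of_bool; apply: eq_in_all => k.
  rewrite mem_iota ltnS => /andP[_ kx].
  rewrite /good -!(ler_nat R) !natrD !natrM.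
  have den0 : (0 < (walk_den k)%:R :> R)%R.
    by rewrite ltr0n prodn_gt0 // => j; rewrite lt0n.
  have normE : ((walk_den k)%:R * `|walk v (take k x)| =
      `|(walk_num 0 (str_code x) k)%:R -
        (walk_num 1 (str_code x) k)%:R| :> R)%R.
    by rewrite walk_num_den // normrM gtr0_norm.
  rewrite -[in RHS](ler_pM2l den0) normE ler_norml.
  by apply/idP/idP => /andP[? ?]; apply/andP; split; lra.
apply: (decidable_rec_all (P := fun k e => good (e 0) k));
  last exact/total_rec_succ/total_rec_trunc_log2/total_rec_var.
have hn t : total_rec 2 (fun e => walk_num t (e 1) (e 0)).
  by apply: (total_rec_app2 (walk_num t)); [exact: total_rec_walk_num| |];
    exact: total_rec_var.
have hd : total_rec 2 (fun e => c * walk_den (e 0)).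
  apply: total_rec_mul; first exact: total_rec_const.
  apply: (total_rec_prod (G := fun j _ => b j)); last exact: total_rec_var.
  by apply: (total_rec_app1 b) => //; exact: total_rec_var.
apply: decidable_rec_and; apply: decidable_rec_leq => //.
  exact: total_rec_add.
exact: total_rec_add.
Qed.

End WalkDecidable.

Local Open Scope ring_scope.

(** * Divergence *)

Lemma sum_exp2V_le {R : realType} n : \sum_(j < n) 2 ^- j <= 2 :> R.
Proof.
(* The remainder of the geometric series makes the induction go through. *)
suff : \sum_(j < n) 2 ^- j + 2 * 2 ^- n <= 2 :> R.
  by apply: le_trans; rewrite lerDl mulr_ge0 // invr_ge0 exprn_ge0.
elim: n => [|n IHn]; first by rewrite big_ord0 expr0 invr1; lra.
by rewrite big_ord_recr /= exprS invfM; lra.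
Qed.

Lemma cvg_series_bounded {R : realType} (u : R^nat) :
  cvgn (series u) -> exists M : R, forall n, `|\sum_(j < n) u j| <= M.
Proof.
move=> /cvg_seq_bounded[M [_ Mb]]; exists (M + 1) => n.
have := Mb (M + 1); rewrite ltrDl ltr01 => /(_ isT n I).
by rewrite /series /= big_mkord.
Qed.

(** From [u ^+ 2 <= 2 * v ^+ 2 + 2 * (u - v) ^+ 2] and the summability of the
    squared errors. *)
Lemma unbounded_sqr_sums {R : realType} (u v : R^nat) :
  (\sum_(0 <= n <oo) ((u n) ^+ 2)%:E = +oo)%E ->
  (forall j, `|u j - v j| <= 2 ^- j) ->
  forall A : R, exists n, A <= \sum_(j < n) v j ^+ 2.
Proof.
move=> u_sqr uv A; apply: contrapT => noA.
have VA n : \sum_(j < n) v j ^+ 2 <= A.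
  by rewrite leNgt; apply/negP => lt; apply: noA; exists n; exact: ltW.
have u2 n : \sum_(j < n) u j ^+ 2 <= 2 * A + 4.
  apply: (@le_trans _ _ (2 * \sum_(j < n) v j ^+ 2 + 2 * \sum_(j < n) 2 ^- j));
    last by have := VA n; have := @sum_exp2V_le R n; lra.
  rewrite !mulr_sumr -big_split /=; apply: ler_sum => j _.
  have e1 : (2 ^- j) <= 1 :> R.
    by rewrite invf_le1 ?exprn_gt0 // exprn_ege1 // ler1n.
  have : (u j - v j) ^+ 2 <= 2 ^- j.
    rewrite -(real_normK (num_real _)) expr2 -[leRHS]mulr1.
    by apply: ler_pM => //; exact: le_trans (uv j) e1.
  have := sqr_ge0 (u j - 2 * v j); rewrite !expr2; lra.
have : (\sum_(0 <= n <oo) ((u n) ^+ 2)%:E <= (2 * A + 4)%:E)%E.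
  apply: lime_le.
    by apply: is_cvg_nneseries => n _ _; rewrite lee_fin sqr_ge0.
  by apply: nearW => n; rewrite sumEFin lee_fin big_mkord.
by rewrite u_sqr.
Qed.

Lemma walk_mkseq {R : realType} (v : R^nat) alpha n :
  walk v (mkseq alpha n) = \sum_(j < n) sgn_bit R (alpha j) * v j.
Proof.
by rewrite /walk size_mkseq; apply: eq_bigr => j _; rewrite nth_mkseq.
Qed.

Theorem theorem2p5 (R : realType) (U : machine)
    (hU : universal_prefix_machine U) (u : R^nat)
    (u_computable : computable_real_seq u)
    (u_sqr : (\sum_(0 <= n <oo) ((u n) ^+ 2)%:E = +oo)%E)
    (eps : R^nat) (eps_random : random_rademacher U eps) :
  ~ cvgn (series (fun n => eps n * u n)).
Proof.
move=> /cvg_series_bounded[M Mb].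
case: u_computable => s [a [b [s_rec a_rec b_rec b0 approx]]].
case: eps_random => alpha KCalpha epsE.
(* The errors of the diagonal approximations add up to at most [2]. *)
pose v : R^nat := fun j => (-1) ^+ s j j * (a j j)%:R / (b j j)%:R.
have uv j : `|u j - v j| <= 2 ^- j by exact: approx.
have [c Mc] : exists c : nat, M + 2 <= c%:R.
  exists (Num.bound `|M + 2|); apply: (le_trans (ler_norm _)); apply: ltW.
  exact: archi_boundP.
have walk_le n : `|walk v (mkseq alpha n)| <= c%:R.
  rewrite walk_mkseq; apply: le_trans Mc.
  have -> : \sum_(j < n) sgn_bit R (alpha j) * v j = \sum_(j < n) eps j * u j -
      \sum_(j < n) eps j * (u j - v j).
    by rewrite -sumrB; apply: eq_bigr => j _; rewrite -epsE; ring.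
  apply: (le_trans (ler_normB _ _)); apply: lerD; first exact: Mb.
  apply: le_trans (sum_exp2V_le n); apply: (le_trans (ler_norm_sum _ _ _)).
  by apply: ler_sum => j _; rewrite normrM epsE norm_sgn_bit mul1r.
(* A step is the difference of two positions in [[-c, c]]. *)
have v_le j : `|v j| <= 2 * c%:R.
  have := walk_le j.+1; have := walk_le j; rewrite !walk_mkseq big_ord_recr /=.
  set w := \sum_(_ < _) _ => w1 w2.
  have -> : `|v j| = `|w + sgn_bit R (alpha j) * v j - w|.
    by rewrite addrAC subrr add0r [RHS]normrM norm_sgn_bit mul1r.
  by apply: (le_trans (ler_normB _ _)); lra.
have diag f : computable2 f -> total_rec 1 (fun e => f (e 0%N) (e 0%N)).
  move=> /computable2_total_rec hf.
  by apply: (total_rec_app2 f hf); exact: total_rec_var.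
apply: (thin_not_KC _ (confined c%:R v) alpha hU) => //.
- exact: (confined_decidable (fun j => s j j) (fun j => a j j) (fun j => b j j)
     _ (diag _ s_rec) (diag _ a_rec) (diag _ b_rec)).
- exact: (confined_thin _ _ _ v_le (unbounded_sqr_sums _ _ u_sqr uv)).
- move=> n; apply/allP => k; rewrite size_mkseq mem_iota ltnS => /andP[_ kn].
  by rewrite /mkseq -map_take take_iota (minn_idPl kn) walk_le.
Qed.
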